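(* Let $m$, $n$ be integers, let $k\ge 0$ be an integer, and let $h\in\mathbb{C}$ satisfy $t^m h^3 - t^m v_{-m} h^2 + v_m h - 1\neq 0$. Then \[ \begin{split} \sum_{j = 0}^k w_{n + jm} h^j &= \frac{t^m w_{n + km} h^{k + 3} - (v_m w_{n + m + km} - w_{n + 2m + km} )h^{k + 2}}{t^m h^3 - t^m v_{ - m} h^2 + v_m h - 1}\\ &\quad+\frac{w_{n + m + km} h^{k + 1} - t^m w_{n - m} h^2 + (v_m w_n - w_{n + m} )h - w_n}{t^m h^3 - t^m v_{ - m} h^2 + v_m h - 1}. \end{split} \]
   Context: Let $a,b,c,r,s,t$ be complex numbers with $t\neq 0$. The sequence $(w_n)=(w_n(a,b,c;r,s,t))$ is defined by $w_0=a$, $w_1=b$, $w_2=c$ and $w_n=rw_{n-1}+sw_{n-2}+tw_{n-3}$ for $n\ge 3$, and is extended to negative indices by $w_{-n}=(w_{-(n-3)}-rw_{-(n-2)}-sw_{-(n-1)})/t$, so that the recurrence holds for all integer indices. The sequence $(v_n)$ is $v_n=w_n(3,r,r^2+2s;r,s,t)$ for all integers $n$. Standing assumption: the three zeros $\alpha,\beta,\gamma$ of $x^3-rx^2-sx-t$ in $\mathbb{C}$ are distinct (so $v_n=\alpha^n+\beta^n+\gamma^n$). *)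

(* Defs.v *)
From HB Require Import structures.
From mathcomp Require Import all_boot all_order all_algebra.
From mathcomp Require Import complex reals.

Set Implicit Arguments.
Unset Strict Implicit.
Unset Printing Implicit Defensive.

Import Order.TTheory GRing.Theory Num.Theory.
Local Open Scope ring_scope.

Section ThirdOrder.
Variable F : fieldType.
Implicit Types (a b c r s t : F) (n : int).

Fixpoint wfwd a b c r s t (k : nat) : F :=
  match k with
  | 0 => a
  | 1 => b
  | 2 => c
  | ((k0.+1 as k1).+1 as k2).+1 =>
      r * wfwd a b c r s t k2 + s * wfwd a b c r s t k1 + t * wfwd a b c r s t k0
  end.

(* [wbwd k] is the term of index 2 - k: the sequence read backwards from c. *)
Fixpoint wbwd a b c r s t (k : nat) : F :=
  match k with
  | 0 => c
  | 1 => b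
  | 2 => a
  | ((k0.+1 as k1).+1 as k2).+1 =>
      (wbwd a b c r s t k0 - r * wbwd a b c r s t k1 - s * wbwd a b c r s t k2) / t
  end.

(* [Negz k] is the integer -(k + 1), i.e. 2 - (k + 3). *)
Definition wseq a b c r s t n : F :=
  match n with
  | Posz k => wfwd a b c r s t k
  | Negz k => wbwd a b c r s t k.+3
  end.

Definition vseq r s t n : F := wseq 3 r (r ^+ 2 + 2 * s) r s t n.

Definition char_poly3 r s t : {poly F} := 'X^3 - r *: 'X^2 - s *: 'X - t%:P.

Lemma wseq_init a b c r s t :
  [/\ wseq a b c r s t 0 = a, wseq a b c r s t 1 = b & wseq a b c r s t 2 = c].
Proof. by []. Qed.

Lemma wseq_neg a b c r s t (k : nat) : (0 < k)%N ->
  wseq a b c r s t (- k%:Z) =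
    (wseq a b c r s t (- (k%:Z - 3)) - r * wseq a b c r s t (- (k%:Z - 2))
       - s * wseq a b c r s t (- (k%:Z - 1))) / t.
Proof.
by case: k => [//|[|[|[|k]]]].
Qed.

Lemma wseq_rec a b c r s t n : t != 0 ->
  wseq a b c r s t n = r * wseq a b c r s t (n - 1)
    + s * wseq a b c r s t (n - 2) + t * wseq a b c r s t (n - 3).
Proof.
move=> t0.
have bwd (k : nat) : (0 < k)%N ->
  wseq a b c r s t (- (k%:Z - 3)) = r * wseq a b c r s t (- (k%:Z - 2))
    + s * wseq a b c r s t (- (k%:Z - 1)) + t * wseq a b c r s t (- k%:Z).
  move=> k0; rewrite (@wseq_neg _ _ _ _ _ _ k k0) [t * _]mulrC divfK //.
  by rewrite -(addrA (wseq _ _ _ _ _ _ _)) -opprD [RHS]addrC subrK.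
have [n3|n3] := leP 3 n.
  case: n n3 => [[|[|[|k]]]|k] // _.
  have -> : k.+3%:Z - 1 = k.+2 by [].
  have -> : k.+3%:Z - 2 = k.+1 by [].
  by have -> : k.+3%:Z - 3 = k by rewrite -[k.+3]addn3 PoszD addrK.
have k0 : 0 < 3 - n by rewrite subr_gt0.
have := bwd `|3 - n|%N; rewrite gtz0_abs // absz_gt0 gt_eqF // => /(_ isT).
have -> : - (3 - n - 3) = n by rewrite addrAC subrr sub0r opprK.
have -> : - (3 - n - 2) = n - 1 by rewrite addrAC opprB opprB.
have -> : - (3 - n - 1) = n - 2 by rewrite addrAC opprB opprB.
by rewrite opprB.
Qed.

End ThirdOrder.

(* Main.v *)
(** Both [w] and [v] have Binet forms in the powers of the zeros, and
    [alpha ^ m], [beta ^ m], [gamma ^ m] are the zeros of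
    [X^3 - v_m X^2 + t^m v_{-m} X - t^m].  Hence [w], sampled with step [m],
    satisfies the corresponding third-order recurrence, and the sum multiplied by
    the denominator telescopes. *)
Require Import Defs.
From HB Require Import structures.
From mathcomp Require Import all_boot all_order all_algebra.
From mathcomp Require Import complex reals.
From mathcomp Require Import ring.

Set Implicit Arguments.
Unset Strict Implicit.
Unset Printing Implicit Defensive.

Import Order.TTheory GRing.Theory Num.Theory.
Local Open Scope ring_scope.

Section LinearRecurrence.
Variable F : fieldType.
Implicit Types (a b c r s t x h : F) (n m : int).

Definition rec3 r s t (u : int -> F) :=
  forall n, u n = r * u (n - 1) + s * u (n - 2) + t * u (n - 3).

(** A window of three consecutive zeros propagates both ways: upwards by the recurrence, downwards
    because [t] is invertible. This serves as the uniqueness principle for sequences on all of the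
    integers. *)
Lemma rec3_eq0 r s t (u : int -> F) : t != 0 -> rec3 r s t u ->
  u 0 = 0 -> u 1 = 0 -> u 2 = 0 -> forall n, u n = 0.
Proof.
move=> t0 urec u0 u1 u2 n.
suff [] : [/\ u n = 0, u (n + 1) = 0 & u (n + 2) = 0] by [].
elim/int_rec: n => [|n [un un1 un2]|n [un un1 un2]]; first by rewrite !add0r.
- rewrite intS; split; first by rewrite addrC.
    by rewrite -un2; congr u; ring.
  rewrite urec.
  have -> : 1 + n%:Z + 2 - 1 = n%:Z + 2 by ring.
  have -> : 1 + n%:Z + 2 - 2 = n%:Z + 1 by ring.
  have -> : 1 + n%:Z + 2 - 3 = n%:Z by ring.
  by rewrite un un1 un2 !mulr0 !addr0.
- rewrite intS; have E1 : u (- (1 + n%:Z) + 1) = 0 by rewrite -un; congr u; ring.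
  have E2 : u (- (1 + n%:Z) + 2) = 0 by rewrite -un1; congr u; ring.
  split=> //.
  (* At this index every term but the one of index [- (1 + n)] is already known to vanish, and its
     coefficient [t] cancels. *)
  have := urec (- n%:Z + 2).
  have -> : - n%:Z + 2 - 1 = - n%:Z + 1 by ring.
  have -> : - n%:Z + 2 - 2 = - n%:Z by ring.
  have -> : - n%:Z + 2 - 3 = - (1 + n%:Z) by ring.
  rewrite un un1 un2 !mulr0 !add0r => /esym/eqP.
  by rewrite mulf_eq0 (negPf t0) => /eqP.
Qed.

Lemma root_char_poly3 r s t x :
  root (char_poly3 r s t) x = (x ^+ 3 == r * x ^+ 2 + s * x + t).
Proof.
by rewrite /root /char_poly3 !hornerE -!addrA -!opprD subr_eq0 !addrA.
Qed.

Lemma rec3_exprz r s t x : x != 0 -> root (char_poly3 r s t) x ->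
  rec3 r s t (exprz x).
Proof.
move=> x0; rewrite root_char_poly3 => /eqP xr n.
have -> : n = n - 3 + 3 by ring.
set p := n - 3.
have -> : p + 3 - 1 = p + 2 by ring.
have -> : p + 3 - 2 = p + 1 by ring.
have -> : p + 3 - 3 = p by ring.
rewrite (expfzDr p 3) // (expfzDr p 2) // (expfzDr p 1) // expr1z.
rewrite (_ : x ^ 2 = x ^+ 2) // (_ : x ^ 3 = x ^+ 3) // xr; ring.
Qed.

(** Divided differences of the three root equations give the coefficients one at a time, with no
    factorization of the polynomial; distinctness permits each division. *)
Lemma vieta_char_poly3 r s t (al be ga : F) :
  all (root (char_poly3 r s t)) [:: al; be; ga] -> uniq [:: al; be; ga] ->
  [/\ r = al + be + ga, s = - (al * be + al * ga + be * ga) & t = al * be * ga].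
Proof.
rewrite /= !root_char_poly3 !inE negb_or !andbT.
move=> /and3P[/eqP ea /eqP eb /eqP eg] /andP[/andP[ab ag] bg].
(* Difference of the equations at [al] and [be], divided by [al - be]; [t] drops out. *)
have eab : al ^+ 2 + al * be + be ^+ 2 = r * (al + be) + s.
  apply: (mulfI (x := al - be)); first by rewrite subr_eq0.
  have -> : (al - be) * (al ^+ 2 + al * be + be ^+ 2) = al ^+ 3 - be ^+ 3 by ring.
  by rewrite ea eb; ring.
have eag : al ^+ 2 + al * ga + ga ^+ 2 = r * (al + ga) + s.
  apply: (mulfI (x := al - ga)); first by rewrite subr_eq0.
  have -> : (al - ga) * (al ^+ 2 + al * ga + ga ^+ 2) = al ^+ 3 - ga ^+ 3 by ring.
  by rewrite ea eg; ring.
have er : r = al + be + ga.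
  apply: (mulfI (x := be - ga)); first by rewrite subr_eq0.
  have -> : (be - ga) * (al + be + ga) =
    (al ^+ 2 + al * be + be ^+ 2) - (al ^+ 2 + al * ga + ga ^+ 2) by ring.
  by rewrite eab eag; ring.
have es : s = - (al * be + al * ga + be * ga).
  have -> : s = r * (al + be) + s - r * (al + be) by ring.
  by rewrite -eab er; ring.
split=> //.
have -> : t = r * al ^+ 2 + s * al + t - (r * al ^+ 2 + s * al) by ring.
by rewrite -ea er es; ring.
Qed.

Section Binet.
Variables (r s t al be ga : F).
Hypothesis t_neq0 : t != 0.
Hypothesis zeros : all (root (char_poly3 r s t)) [:: al; be; ga].
Hypothesis distinct : uniq [:: al; be; ga].

Let zeros_neq0 : [/\ al != 0, be != 0 & ga != 0].
Proof.
have [_ _ et] := vieta_char_poly3 zeros distinct.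
by move: t_neq0; rewrite et !mulf_eq0 !negb_or => /andP[/andP[-> ->] ->].
Qed.

(** Both sides satisfy the recurrence and agree at 0, 1, 2. With the initial values in this shape, a
    Binet form reduces to matching three initial values. *)
Lemma wseq_geometric (p q z : F) n :
  wseq (p + q + z) (p * al + q * be + z * ga)
       (p * al ^+ 2 + q * be ^+ 2 + z * ga ^+ 2) r s t n =
  p * al ^ n + q * be ^ n + z * ga ^ n.
Proof.
have [al0 be0 ga0] := zeros_neq0.
have /= /and4P[ra rb rg _] := zeros.
set w := wseq _ _ _ _ _ _.
apply/eqP; rewrite -subr_eq0; apply/eqP; move: n.
apply: (@rec3_eq0 r s t (fun n => w n - (p * al ^ n + q * be ^ n + z * ga ^ n)) t_neq0).
- have wrec : rec3 r s t w by move=> n; apply: wseq_rec.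
  have := rec3_exprz ga0 rg; have := rec3_exprz be0 rb; have := rec3_exprz al0 ra.
  (* The sequences become opaque, so that [ring] treats their values as atoms. *)
  clearbody w; move: (exprz al) (exprz be) (exprz ga) => x y u xrec yrec urec n.
  rewrite wrec xrec yrec urec; ring.
- by rewrite !expr0z !mulr1 subrr.
- by rewrite !expr1z subrr.
- by rewrite /= !(_ : forall x : F, x ^ 2 = x ^+ 2) // subrr.
Qed.

(** By Vieta, [3], [r] and [r ^+ 2 + 2 * s] are the power sums of the zeros of exponents 0, 1, 2. *)
Lemma vseq_binet n : vseq r s t n = al ^ n + be ^ n + ga ^ n.
Proof.
have [er es _] := vieta_char_poly3 zeros distinct.
have := wseq_geometric 1 1 1 n; rewrite !mul1r => <-.
by rewrite /vseq; congr (wseq _ _ _ _ _ _ _); rewrite ?er ?es; ring.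
Qed.

Lemma wseq_binet a b c : exists p q z,
  forall n, wseq a b c r s t n = p * al ^ n + q * be ^ n + z * ga ^ n.
Proof.
have := distinct; rewrite /= !inE negb_or andbT => /andP[/andP[ab ag] bg].
have [dab dag dbg] : [/\ al - be != 0, al - ga != 0 & be - ga != 0].
  by rewrite !subr_eq0.
(* Solution of the Vandermonde system: each weight is a Lagrange basis polynomial at the zeros, with
   1, X, X^2 replaced by [a], [b], [c]. *)
pose p := (c - (be + ga) * b + be * ga * a) / ((al - be) * (al - ga)).
pose q := (c - (al + ga) * b + al * ga * a) / ((be - al) * (be - ga)).
pose z := (c - (al + be) * b + al * be * a) / ((ga - al) * (ga - be)).
have [dba dga dgb] : [/\ be - al != 0, ga - al != 0 & ga - be != 0].
  by split; rewrite subr_eq0 eq_sym.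
exists p, q, z => n; rewrite -wseq_geometric.
congr (wseq _ _ _ _ _ _ _); rewrite /p /q /z; field;
  by rewrite ?dab ?dag ?dbg ?dba ?dga ?dgb.
Qed.

(** Since [t] is the product of the zeros, [t ^ m * v (- m)] is the second elementary symmetric
    function of their [m]-th powers. Each such power x thus satisfies x^2 = v_m x - t^m v_{-m} + t^m
    / x, and the Binet form combines these linearly. *)
Lemma wseq_step a b c m n (w := wseq a b c r s t) (v := vseq r s t) :
  w (n + 2 * m) = v m * w (n + m) - t ^ m * v (- m) * w n + t ^ m * w (n - m).
Proof.
have [al0 be0 ga0] := zeros_neq0.
have [_ _ et] := vieta_char_poly3 zeros distinct.
have [p [q [z wE]]] := wseq_binet a b c.
rewrite /w /v !wE !vseq_binet et !expfzMl mulrDl !mul1r !addrA !expfzDr //.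
rewrite -!invr_expz.
have := expfz_neq0 m al0; have := expfz_neq0 m be0; have := expfz_neq0 m ga0.
move: (al ^ m) (be ^ m) (ga ^ m) => x y u u0 y0 x0.
by field; rewrite x0 y0 u0.
Qed.

End Binet.

(** The telescoping is purely formal: it uses only the step-[m] recurrence, for arbitrary
    coefficients. Being free of division, it goes by induction on [k]. *)
Lemma sum_step_rec (A U V h : F) (w : int -> F) n m (k : nat) :
  (forall n, w (n + 2 * m) = V * w (n + m) - A * U * w n + A * w (n - m)) ->
  (\sum_(0 <= j < k.+1) w (n + j%:Z * m) * h ^+ j)
    * (A * h ^+ 3 - A * U * h ^+ 2 + V * h - 1) =
  A * w (n + k%:Z * m) * h ^+ (k + 3)
    - (V * w (n + m + k%:Z * m) - w (n + 2 * m + k%:Z * m)) * h ^+ (k + 2)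
  + (w (n + m + k%:Z * m) * h ^+ (k + 1) - A * w (n - m) * h ^+ 2
    + (V * w n - w (n + m)) * h - w n).
Proof.
move=> wrec; elim: k => [|k IHk].
  by rewrite big_nat1 mul0r !addr0 !add0n wrec; ring.
rewrite big_nat_recr //= mulrDl IHk.
(* Relative to the index [N] of the new summand, all moving indices are [N - m], [N], [N + m] and
   [N + 2 * m], so one use of the recurrence suffices. *)
pose N := n + k.+1%:Z * m.
have -> : n + k%:Z * m = N - m by rewrite /N intS; ring.
have -> : n + m + k%:Z * m = N by rewrite /N intS; ring.
have -> : n + 2 * m + k%:Z * m = N + m by rewrite /N intS; ring.
have -> : n + m + k.+1%:Z * m = N + m by rewrite /N; ring.
have -> : n + 2 * m + k.+1%:Z * m = N + 2 * m by rewrite /N; ring.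
rewrite -/N wrec !addn1 !addn2 !addn3 !exprS; ring.
Qed.

End LinearRecurrence.

Theorem theorem3 (R : realType) (a b c r s t : R[i]) (t_neq0 : t != 0)
  (alpha beta gamma : R[i])
  (zeros : all (root (char_poly3 r s t)) [:: alpha; beta; gamma])
  (zeros_distinct : uniq [:: alpha; beta; gamma])
  (m n : int) (k : nat) (h : R[i])
  (w := wseq a b c r s t) (v := vseq r s t)
  (den_neq0 : t ^ m * h ^+ 3 - t ^ m * v (- m) * h ^+ 2 + v m * h - 1 != 0) :
  \sum_(0 <= j < k.+1) w (n + j%:Z * m) * h ^+ j =
    (t ^ m * w (n + k%:Z * m) * h ^+ (k + 3)
      - (v m * w (n + m + k%:Z * m) - w (n + 2 * m + k%:Z * m)) * h ^+ (k + 2))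
    / (t ^ m * h ^+ 3 - t ^ m * v (- m) * h ^+ 2 + v m * h - 1)
    + (w (n + m + k%:Z * m) * h ^+ (k + 1) - t ^ m * w (n - m) * h ^+ 2
      + (v m * w n - w (n + m)) * h - w n)
    / (t ^ m * h ^+ 3 - t ^ m * v (- m) * h ^+ 2 + v m * h - 1).
Proof.
rewrite -mulrDl; apply: (mulIf den_neq0); rewrite divfK //.
by apply: sum_step_rec => p; apply: (wseq_step t_neq0 zeros zeros_distinct).
Qed.
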